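(* Let $(\mathfrak g,[\cdot,\dots,\cdot])$ be an $n$-Lie algebra, let $f\in\mathfrak g^*$ satisfy $f([x_1,\dots,x_n])=0$ for all $x_1,\dots,x_n\in\mathfrak g$, and let $\mathfrak g_f=(\mathfrak g,\{\cdot,\dots,\cdot\})$ be the $(n+1)$-Lie algebra with bracket $\{x_1,\dots,x_{n+1}\}=\sum_{i=1}^{n+1}(-1)^{i-1}f(x_i)[x_1,\dots,\hat{x_i},\dots,x_{n+1}]$. If $N$ is a Nijenhuis operator on the $n$-Lie algebra $(\mathfrak g,[\cdot,\dots,\cdot])$, then $N$ is also a Nijenhuis operator on the $(n+1)$-Lie algebra $(\mathfrak g_f,\{\cdot,\dots,\cdot\})$.
   Context: Let $n\ge 2$. For $m\ge2$, an $m$-Lie algebra is a vector space $\mathfrak g$ with an $m$-multilinear skew-symmetric bracket $[\cdot,\dots,\cdot]:\wedge^m\mathfrak g\to\mathfrak g$ satisfying $[x_1,\dots,x_{m-1},[y_1,\dots,y_m]]=\sum_{i=1}^m[y_1,\dots,[x_1,\dots,x_{m-1},y_i],\dots,y_m]$ for all $x_i,y_i\in\mathfrak g$. A hat denotes omission and $\mathfrak g^*$ is the dual space of $\mathfrak g$. It is a known fact that, under the stated condition on $f$, $\mathfrak g_f$ is an $(n+1)$-Lie algebra. For a linear map $N$ on an $m$-Lie algebra, define $m$-ary brackets $[\cdot,\dots,\cdot]_N^j$, $1\le j\le m-1$, by $[x_1,\dots,x_m]_N^1=\sum_{i=1}^m[x_1,\dots,Nx_i,\dots,x_m]-N[x_1,\dots,x_m]$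 and, for $2\le j\le m-1$, $[x_1,\dots,x_m]_N^j=\sum_{i_1<\dots<i_j}[\dots,Nx_{i_1},\dots,Nx_{i_j},\dots]-N[x_1,\dots,x_m]_N^{j-1}$, where in the summand $N$ is applied exactly to the entries in positions $i_1,\dots,i_j$. The linear map $N$ is a Nijenhuis operator on the $m$-Lie algebra if $[Nx_1,\dots,Nx_m]=N([x_1,\dots,x_m]_N^{m-1})$ for all $x_1,\dots,x_m$. *)

(* Defs.v *)
From HB Require Import structures.
From mathcomp Require Import all_boot all_order all_algebra all_fingroup zify ring.

Set Implicit Arguments.
Unset Strict Implicit.
Unset Printing Implicit Defensive.

Import GRing.Theory.
Local Open Scope ring_scope.

Definition upd (V : Type) (m : nat) (x : {ffun 'I_m -> V}) (i : 'I_m) (u : V) :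
    {ffun 'I_m -> V} :=
  [ffun j => if j == i then u else x j].

(* (x_1, ..., x_{m-1}, z) *)
Definition append (V : Type) (m : nat) (x : {ffun 'I_m.-1 -> V}) (z : V) :
    {ffun 'I_m -> V} :=
  [ffun i : 'I_m => oapp x z (insub (val i))].

Definition omit (V : Type) (m : nat) (x : {ffun 'I_m -> V}) (i : 'I_m) :
    {ffun 'I_m.-1 -> V} :=
  [ffun j => x (lift i j)].

(* m-Lie algebra structures on the K-space V, which may be infinite dimensional.
   The bracket being defined on the m-th exterior power, it vanishes on tuples
   with a repeated entry; in characteristic 2 this says more than the sign rule
   under permutations, which it implies in general (bracket_perm below). *)
Record mLie (K : fieldType) (m : nat) (V : lmodType K) := MLie {
  bracket :> {ffun 'I_m -> V} -> V;
  bracket_multilinear :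
    forall (x : {ffun 'I_m -> V}) (i : 'I_m) (a : K) (u v : V),
      bracket (upd x i (a *: u + v))
      = a *: bracket (upd x i u) + bracket (upd x i v);
  bracket_alternating :
    forall (x : {ffun 'I_m -> V}) (i j : 'I_m),
      i != j -> x i = x j -> bracket x = 0;
  bracket_fundamental :
    forall (x : {ffun 'I_m.-1 -> V}) (y : {ffun 'I_m -> V}),
      bracket (append x (bracket y))
      = \sum_(i < m) bracket (upd y i (bracket (append x (y i))))
}.

Definition apply_at (V : Type) (m : nat) (N : V -> V) (I : {set 'I_m})
    (x : {ffun 'I_m -> V}) : {ffun 'I_m -> V} :=
  [ffun i => if i \in I then N (x i) else x i].

(* Starting the recursion at the bracket itself for j = 0 gives the separately
   stated formula for j = 1. Position sets i_1 < ... < i_j are j-element sets. *)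
Fixpoint bracketN (K : fieldType) (m : nat) (V : lmodType K) (g : mLie m V)
    (N : {linear V -> V}) (j : nat) (x : {ffun 'I_m -> V}) : V :=
  if j is j'.+1 then
    \sum_(I : {set 'I_m} | #|I| == j) g (apply_at N I x) - N (bracketN g N j' x)
  else g x.

Definition Nijenhuis (K : fieldType) (m : nat) (V : lmodType K) (g : mLie m V)
    (N : {linear V -> V}) : Prop :=
  forall x : {ffun 'I_m -> V}, g [ffun i => N (x i)] = N (bracketN g N m.-1 x).

(* With indices starting at 0 the sign (-1)^(i-1) becomes (-1)^i. *)
Definition extend_bracket (K : fieldType) (n : nat) (V : lmodType K)
    (g : mLie n V) (f : {scalar V}) (x : {ffun 'I_n.+1 -> V}) : V :=
  \sum_(i < n.+1) ((-1) ^+ i * f (x i)) *: g (omit x i).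

Lemma updE (V : Type) (m : nat) (x : {ffun 'I_m -> V}) (i j : 'I_m) (u : V) :
  upd x i u j = if j == i then u else x j.
Proof. by rewrite ffunE. Qed.

Lemma upd_id (V : Type) (m : nat) (x : {ffun 'I_m -> V}) (i : 'I_m) :
  upd x i (x i) = x.
Proof. by apply/ffunP => j; rewrite updE; case: eqP => [->|]. Qed.

Lemma omit_upd_same (V : Type) (m : nat) (x : {ffun 'I_m -> V}) (i : 'I_m)
    (u : V) : omit (upd x i u) i = omit x i.
Proof. by apply/ffunP => j; rewrite !ffunE eq_sym (negPf (neq_lift i j)). Qed.

Lemma omit_upd_lift (V : Type) (m : nat) (x : {ffun 'I_m -> V}) (i : 'I_m)
    (k : 'I_m.-1) (u : V) :
  omit (upd x (lift i k) u) i = upd (omit x i) k u.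
Proof. by apply/ffunP => j; rewrite !ffunE (inj_eq lift_inj). Qed.

Lemma bracketD (K : fieldType) (m : nat) (V : lmodType K) (g : mLie m V)
    (x : {ffun 'I_m -> V}) (i : 'I_m) (u v : V) :
  g (upd x i (u + v)) = g (upd x i u) + g (upd x i v).
Proof. by have := bracket_multilinear g x i 1 u v; rewrite !scale1r. Qed.

Lemma bracket0 (K : fieldType) (m : nat) (V : lmodType K) (g : mLie m V)
    (x : {ffun 'I_m -> V}) (i : 'I_m) : g (upd x i 0) = 0.
Proof.
by apply: (addrI (g (upd x i 0))); rewrite addr0 -bracketD addr0.
Qed.

Lemma bracketZ (K : fieldType) (m : nat) (V : lmodType K) (g : mLie m V)
    (x : {ffun 'I_m -> V}) (i : 'I_m) (a : K) (u : V) :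
  g (upd x i (a *: u)) = a *: g (upd x i u).
Proof. by rewrite -[a *: u]addr0 bracket_multilinear bracket0 addr0. Qed.

Lemma bracket_sum (K : fieldType) (m : nat) (V : lmodType K) (g : mLie m V)
    (x : {ffun 'I_m -> V}) (i : 'I_m) (I : finType) (P : pred I) (F : I -> V) :
  g (upd x i (\sum_(k | P k) F k)) = \sum_(k | P k) g (upd x i (F k)).
Proof.
by apply: (big_morph (fun u => g (upd x i u))) => [u v|];
  [exact: bracketD | exact: bracket0].
Qed.

Lemma bracket_tperm (K : fieldType) (m : nat) (V : lmodType K) (g : mLie m V)
    (x : {ffun 'I_m -> V}) (i j : 'I_m) :
  i != j -> g [ffun k => x (tperm i j k)] = - g x.
Proof.
move=> nij; have nji : j != i by rewrite eq_sym.
pose h u v := g (upd (upd x i u) j v).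
have h0 u : h u u = 0.
  apply: (bracket_alternating g nij).
  by rewrite !updE !eqxx (negPf nij).
have swap u v : upd (upd x i u) j v = upd (upd x j v) i u.
  by apply/ffunP => k; rewrite !updE; case: eqVneq => // ->; rewrite (negPf nji).
have hDr u v w : h u (v + w) = h u v + h u w by rewrite /h bracketD.
have hDl u v w : h (v + w) u = h v u + h w u by rewrite /h !swap bracketD.
have hx : h (x i) (x j) = g x by rewrite /h upd_id upd_id.
have hs : h (x j) (x i) = g [ffun k => x (tperm i j k)].
  congr (g _); apply/ffunP => k; rewrite !updE ffunE.
  by case: tpermP => [->|->|/eqP/negPf-> /eqP/negPf->] //;
    rewrite ?eqxx ?(negPf nij).
apply/eqP; rewrite -hs -hx -addr_eq0 addrC; apply/eqP.
by have := h0 (x i + x j); rewrite hDl !hDr !h0 add0r addr0.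
Qed.

Lemma bracket_perm (K : fieldType) (m : nat) (V : lmodType K) (g : mLie m V)
    (x : {ffun 'I_m -> V}) (s : 'S_m) :
  g [ffun i => x (s i)] = (-1) ^+ s *: g x.
Proof.
have [ts -> ds] := prod_tpermP s.
elim: ts ds x {s} => [|t ts IHts] /= => [_|/andP[dt dts]] x.
  rewrite big_nil odd_perm1 scale1r; congr (g _).
  by apply/ffunP => i; rewrite ffunE perm1.
rewrite big_cons odd_mul_tperm dt signr_addb -scalerA -IHts // scaleN1r.
rewrite -(bracket_tperm g _ dt); congr (g _).
by apply/ffunP => i; rewrite !ffunE permM.
Qed.

Lemma bracket_omit_repeat (K : fieldType) (n : nat) (V : lmodType K)
    (g : mLie n V) (z : {ffun 'I_n.+1 -> V}) (k l : 'I_n.+1) :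
  k != l -> z k = z l ->
  (-1) ^+ k *: g (omit z k) = - ((-1) ^+ l *: g (omit z l)).
Proof.
move=> nkl ezkl; pose t := tperm k l.
have zt i : z (t i) = z i by rewrite /t; case: tpermP => [->|->|].
pose s (j : 'I_n) : 'I_n := odflt j (unlift l (t (lift k j))).
have sE j : lift l (s j) = t (lift k j).
  rewrite /s; case: unliftP => [j' -> //|] /= E.
  by have /eqP := neq_lift k j; case; apply: (@perm_inj _ t); rewrite E tpermL.
have sI : injective s.
  by move=> i j /(congr1 (lift l)); rewrite !sE => /perm_inj/lift_inj.
pose p := perm sI.
have tE : t = lift_perm k l p.
  apply/permP => i; case: (unliftP k i) => [j ->|->].
    by rewrite lift_perm_lift (permE sI) sE.
  by rewrite lift_perm_id tpermL.
have zE : omit z k = [ffun i => omit z l (p i)].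
  apply/ffunP => i; rewrite [LHS]ffunE [RHS]ffunE [RHS]ffunE.
  by rewrite (permE sI) sE zt.
have : odd_perm t by rewrite odd_tperm.
rewrite tE odd_lift_perm zE bracket_perm scalerA -(signr_odd _ k) -signr_addb.
rewrite -scaleNr -(signr_odd _ l) -[X in X *: _ = _]/((-1) ^+ (odd k (+) p)).
by case: (odd k) (odd l) (p : bool) => [] [] []; rewrite //= ?expr0 ?expr1 ?opprK.
Qed.

Lemma extend_multilinear (K : fieldType) (n : nat) (V : lmodType K)
    (g : mLie n V) (f : {scalar V}) (x : {ffun 'I_n.+1 -> V}) (i : 'I_n.+1)
    (a : K) (u v : V) :
  extend_bracket g f (upd x i (a *: u + v))
  = a *: extend_bracket g f (upd x i u) + extend_bracket g f (upd x i v).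
Proof.
rewrite scaler_sumr -big_split; apply: eq_bigr => k _ /=; rewrite !updE.
case: (unliftP k i) => [i' ->|->].
  rewrite (negPf (neq_lift k i')) !omit_upd_lift bracket_multilinear scalerDr.
  by rewrite !scalerA [a * _]mulrC.
by rewrite eqxx !omit_upd_same linearP mulrDr scalerDl scalerA mulrCA.
Qed.

Lemma extend_alternating (K : fieldType) (n : nat) (V : lmodType K)
    (g : mLie n V) (f : {scalar V}) (x : {ffun 'I_n.+1 -> V}) (i j : 'I_n.+1) :
  i != j -> x i = x j -> extend_bracket g f x = 0.
Proof.
move=> nij exij; rewrite /extend_bracket (bigD1 i) //= (bigD1 j) 1?eq_sym //=.
rewrite big1 ?addr0 => [|k /andP[nki nkj]].
  rewrite ![_ * f _]mulrC -!scalerA (bracket_omit_repeat g nij exij) exij.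
  by rewrite scalerN addNr.
have [i' Ei _] := unlift_some nki; have [j' Ej _] := unlift_some nkj.
rewrite (bracket_alternating g (x := omit x k) (i := i') (j := j')) ?scaler0 //.
  by apply: contraNneq nij => E; rewrite Ei Ej E.
by rewrite !ffunE -Ei -Ej.
Qed.

Lemma append_lt (V : Type) (m : nat) {x : {ffun 'I_m.-1 -> V}} {z : V}
    {i : 'I_m} (j : 'I_m.-1) : val i = val j -> append x z i = x j.
Proof. by move=> E; rewrite ffunE E valK. Qed.

Lemma append_last (V : Type) (m : nat) {x : {ffun 'I_m.-1 -> V}} {z : V}
    {i : 'I_m} : i.+1 = m -> append x z i = z.
Proof. by move=> E; rewrite ffunE insubN //= -ltnS -{2}E /= ltnn. Qed.

(* Expansion of {x_1, ..., x_n, z} splitting off the term omitting z. *)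
Lemma extend_append (K : fieldType) (n : nat) (V : lmodType K) (g : mLie n V)
    (f : {scalar V}) (x : {ffun 'I_n -> V}) (z : V) :
  extend_bracket g f (@append V n.+1 x z)
  = \sum_(i < n) ((-1) ^+ i * f (x i)) *: g (append (omit x i) z)
    + ((-1) ^+ n * f z) *: g x.
Proof.
rewrite /extend_bracket big_ord_recr /= append_last //; congr (_ + _ *: g _).
  apply: eq_bigr => i _; rewrite (append_lt (m := n.+1) (j := i)) //.
  congr (_ *: g _).
  apply/ffunP => j; rewrite [RHS]ffunE ffunE /=.
  case: insubP => [k _ /= Ek|] /=.
    rewrite (append_lt (m := n.+1) (j := lift i k)) ?ffunE //=.
    by rewrite /= Ek.
  rewrite -leqNgt => le; apply: append_last => /=.
  by move: (ltn_ord i) (ltn_ord j) le; rewrite /bump; case: leqP => /=; lia.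
apply/ffunP => j; rewrite ffunE (append_lt (m := n.+1) (j := j)) //=.
by rewrite /bump leqNgt ltn_ord.
Qed.

Lemma bracket_append_sum (K : fieldType) (m : nat) (V : lmodType K)
    (g : mLie m V) (x : {ffun 'I_m.-1 -> V}) (r : nat) (c : 'I_r -> K)
    (F : 'I_r -> V) :
  (0 < m)%N ->
  g (append x (\sum_k c k *: F k)) = \sum_k c k *: g (append x (F k)).
Proof.
move=> m0; have ltm : (m.-1 < m)%N by rewrite prednK.
pose e := Ordinal ltm.
have aE z : append x z = upd (append x 0) e z.
  apply/ffunP => i; rewrite updE; case: eqVneq => [->|ne].
    by rewrite append_last //= prednK.
  have lti : (i < m.-1)%N.
    by have := ltn_ord i; move: ne; rewrite -val_eqE /=; lia.
  by rewrite !(append_lt (j := Ordinal lti)).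
rewrite aE bracket_sum; apply: eq_bigr => k _.
by rewrite bracketZ -aE.
Qed.

Lemma sum_antisym (V : zmodType) (r : nat) (A : 'I_r -> 'I_r -> V) :
  (forall k l, k != l -> A k l = - A l k) ->
  \sum_k \sum_(l | l != k) A k l = 0.
Proof.
move=> hA.
have E k : \sum_(l | l != k) A k l
    = \sum_(l < r | (l < k)%N) A k l + \sum_(l < r | (k < l)%N) A k l.
  rewrite (bigID (fun l : 'I_r => (l < k)%N)) /=; congr (_ + _);
    by apply: eq_bigl => l; rewrite -val_eqE /=; lia.
rewrite (eq_bigr _ (fun k _ => E k)) big_split /=.
rewrite [X in _ + X](exchange_big_dep predT) //= -big_split big1 // => k _ /=.
rewrite -big_split big1 // => l lk /=.
by rewrite (hA k l) ?addNr // -val_eqE /=; lia.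
Qed.

Lemma extend_fundamental (K : fieldType) (n : nat) (V : lmodType K)
    (g : mLie n V) (f : {scalar V})
    (hf : forall x : {ffun 'I_n -> V}, f (g x) = 0)
    (x : {ffun 'I_n.+1.-1 -> V}) (y : {ffun 'I_n.+1 -> V}) :
  extend_bracket g f (append x (extend_bracket g f y))
  = \sum_(i < n.+1)
      extend_bracket g f (upd y i (extend_bracket g f (append x (y i)))).
Proof.
have fe w : f (extend_bracket g f w) = 0.
  by rewrite linear_sum big1 // => i _; rewrite linearZ /= hf mulr0.
have hupd l w : f w = 0 -> extend_bracket g f (upd y l w)
    = \sum_(k | k != l) ((-1) ^+ k * f (y k)) *: g (omit (upd y l w) k).
  move=> fw; rewrite /extend_bracket (bigD1 l) //= updE eqxx fw mulr0 scale0r.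
  by rewrite add0r; apply: eq_bigr => k nkl; rewrite updE (negPf nkl).
rewrite extend_append fe mulr0 scale0r addr0.
rewrite [RHS](eq_bigr _ (fun l _ => hupd l _ (fe _))).
rewrite [RHS](exchange_big_dep predT) //=.
pose a (i : 'I_n) := (-1) ^+ i * f (x i).
pose b (k : 'I_n.+1) := (-1) ^+ k * f (y k).
pose T k l := \sum_(i < n)
  a i *: g (omit (upd y l (g (append (omit x i) (y l)))) k).
pose S k l := (b k * ((-1) ^+ n * f (y l))) *: g (omit (upd y l (g x)) k).
have TS k l : l != k ->
    b k *: g (omit (upd y l (extend_bracket g f (append x (y l)))) k)
    = b k *: T k l + S k l.
  case: (unliftP k l) => [j ->|->]; last by rewrite eqxx.
  move=> _; rewrite extend_append /S /T !omit_upd_lift bracketD bracket_sum.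
  rewrite bracketZ scalerDr scalerA; congr (b k *: _ + _).
  by apply: eq_bigr => i _; rewrite omit_upd_lift bracketZ.
have -> : \sum_k \sum_(l | k != l)
      b k *: g (omit (upd y l (extend_bracket g f (append x (y l)))) k)
    = \sum_k b k *: (\sum_(l | l != k) T k l).
  transitivity (\sum_k (b k *: (\sum_(l | l != k) T k l)
      + \sum_(l | l != k) S k l)).
    apply: eq_bigr => k _; rewrite scaler_sumr -big_split /=.
    by apply: eq_big => [l|l nkl]; rewrite 1?eq_sym // TS // eq_sym.
  rewrite big_split /= sum_antisym ?addr0 // => k l nkl; rewrite /S /b.
  pose z := upd (upd y l (g x)) k (g x).
  have zE : z = upd (upd y k (g x)) l (g x).
    by apply/ffunP => i; rewrite !updE; do 2?case: eqP.
  have E : (-1) ^+ k *: g (omit (upd y l (g x)) k)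
      = - ((-1) ^+ l *: g (omit (upd y k (g x)) l)).
    rewrite -(omit_upd_same (upd y l (g x)) k (g x)) -/z.
    rewrite (bracket_omit_repeat g nkl) ?zE ?omit_upd_same //.
    by rewrite !updE !eqxx (negPf nkl).
  have -> : (-1) ^+ k * f (y k) * ((-1) ^+ n * f (y l))
      = (-1) ^+ n * f (y k) * f (y l) * (-1) ^+ k by ring.
  rewrite -scalerA E scalerN scalerA; congr (- (_ *: _)); ring.
rewrite (eq_bigr (fun i => \sum_k (a i * b k) *:
   \sum_(j < n) g (upd (omit y k) j (g (append (omit x i) (y (lift k j))))))).
  rewrite exchange_big; apply: eq_bigr => k _ /=.
  have -> : \sum_(l | l != k) T k l = \sum_(j < n) T k (lift k j).
    apply: (addrI (T k k)).
    by rewrite -(@bigD1_ord _ _ _ _ k predT (T k) isT) [RHS](bigD1 k).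
  rewrite /T exchange_big scaler_sumr; apply: eq_bigr => i _ /=.
  rewrite mulrC -scalerA -scaler_sumr; congr (_ *: (_ *: _)).
  by apply: eq_bigr => j _; rewrite omit_upd_lift.
move=> i _; rewrite -/(a i) bracket_append_sum; last by case: (n) i => // -[].
rewrite scaler_sumr; apply: eq_bigr => k _; rewrite scalerA -/(b k).
rewrite bracket_fundamental; congr (_ *: _).
by apply: eq_bigr => j _; rewrite [omit y k j]ffunE.
Qed.

(* g_f *)
Definition extend (K : fieldType) (n : nat) (V : lmodType K) (g : mLie n V)
    (f : {scalar V}) (hf : forall x : {ffun 'I_n -> V}, f (g x) = 0) :
    mLie n.+1 V :=
  MLie (extend_multilinear g f) (@extend_alternating K n V g f)
    (extend_fundamental hf).

(* Main.v *)
(** Extend the recursion defining [x]_N^j to j = m: being Nijenhuis means that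
    [x]_N^m = 0 identically.  An entry x_i of an (n+1)-tuple either keeps its
    place in f or is replaced by N x_i, so
      {x}_N^(j+1) = sum_i (-1)^i (f(x_i) [x without x_i]_N^(j+1)
                                  + f(N x_i) [x without x_i]_N^j),
    and for j = n both brackets on the right vanish. *)
Require Import Defs.
From mathcomp Require Import all_boot all_order all_algebra.

Import GRing.Theory.
Local Open Scope ring_scope.

(** Preimage under [lift i] renumbers the positions that survive once [i] is dropped. *)
Lemma omit_apply_at (V : Type) (n : nat) (N : V -> V) (I : {set 'I_n.+1})
    (x : {ffun 'I_n.+1 -> V}) (i : 'I_n.+1) :
  omit (apply_at N I x) i = apply_at N (lift i @^-1: I) (omit x i).
Proof. by apply/ffunP => j; rewrite !ffunE inE. Qed.

Lemma preimset_lift_imset (n : nat) (i : 'I_n.+1) (J : {set 'I_n}) :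
  lift i @^-1: (lift i @: J) = J.
Proof. by apply/setP => j; rewrite inE mem_imset //; apply: lift_inj. Qed.

Lemma preimset_lift_setU1 (n : nat) (i : 'I_n.+1) (J : {set 'I_n}) :
  lift i @^-1: (i |: lift i @: J) = J.
Proof.
apply/setP => j; rewrite inE in_setU1 eq_sym (negPf (neq_lift i j)) /=.
by rewrite mem_imset //; apply: lift_inj.
Qed.

Lemma lift_notin_imset (n : nat) (i : 'I_n.+1) (J : {set 'I_n}) :
  i \notin lift i @: J.
Proof. by apply/imsetP => -[j _ /eqP]; rewrite (negPf (neq_lift i j)). Qed.

Lemma imset_lift_preimset (n : nat) (i : 'I_n.+1) (I : {set 'I_n.+1}) :
  lift i @: (lift i @^-1: I) = I :\ i.
Proof.
apply/setP => k; rewrite in_setD1; case: (unliftP i k) => [j ->|->].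
  by rewrite mem_imset ?inE 1?eq_sym ?neq_lift //; apply: lift_inj.
by rewrite eqxx (negPf (lift_notin_imset _ _ _)).
Qed.

(** Deleting [i] is a bijection from the sets avoiding [i], and from those containing it, onto
    subsets of ['I_n]; only in the second case does the cardinality drop. *)
Lemma sum_card_preimset_lift (V : zmodType) (n : nat) (i : 'I_n.+1) (j : nat)
    (F : bool -> {set 'I_n} -> V) :
  \sum_(I : {set 'I_n.+1} | #|I| == j.+1) F (i \in I) (lift i @^-1: I)
  = \sum_(J : {set 'I_n} | #|J| == j.+1) F false J
    + \sum_(J : {set 'I_n} | #|J| == j) F true J.
Proof.
rewrite (bigID (fun I : {set 'I_n.+1} => i \notin I)) /=; congr (_ + _).
  rewrite (reindex_onto (fun J : {set 'I_n} => lift i @: J)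
    (fun I : {set 'I_n.+1} => lift i @^-1: I)) /=.
    apply: eq_big => [J|J _]; last first.
      by rewrite preimset_lift_imset (negPf (lift_notin_imset _ i J)).
    rewrite preimset_lift_imset lift_notin_imset eqxx !andbT.
    by rewrite card_imset //; apply: lift_inj.
  move=> I /andP[_ niI]; rewrite imset_lift_preimset.
  by apply/setDidPl; rewrite disjoint_sym disjoints1.
(* The sets containing [i]: the inverse of deletion must put [i] back. *)
rewrite (reindex_onto (fun J : {set 'I_n} => i |: lift i @: J)
    (fun I : {set 'I_n.+1} => lift i @^-1: I)) /=.
  apply: eq_big => [J|J _]; last by rewrite preimset_lift_setU1 setU11.
  rewrite preimset_lift_setU1 setU11 eqxx !andbT cardsU1 lift_notin_imset.
  by rewrite card_imset //; apply: lift_inj.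
by move=> I /andP[_ /negPn iI]; rewrite imset_lift_preimset setD1K.
Qed.

Lemma sum_extend_apply_at (K : fieldType) (V : lmodType K) (n : nat)
    (g : mLie n V) (f : {scalar V}) (N : V -> V) (j : nat)
    (x : {ffun 'I_n.+1 -> V}) :
  \sum_(I : {set 'I_n.+1} | #|I| == j.+1) extend_bracket g f (apply_at N I x)
  = \sum_(i < n.+1)
      (((-1) ^+ i * f (x i)) *:
         \sum_(J : {set 'I_n} | #|J| == j.+1) g (apply_at N J (omit x i))
       + ((-1) ^+ i * f (N (x i))) *:
         \sum_(J : {set 'I_n} | #|J| == j) g (apply_at N J (omit x i))).
Proof.
rewrite exchange_big; apply: eq_bigr => i _ /=; rewrite !scaler_sumr.
(* In the term omitting [i], membership of [i] in [I] affects only the argument of [f]; the boolean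
   [b] records it. *)
rewrite -(sum_card_preimset_lift _ _ i j (fun b J =>
  ((-1) ^+ i * f (if b then N (x i) else x i)) *:
    g (apply_at N J (omit x i)))).
by apply: eq_bigr => I _; rewrite omit_apply_at ffunE.
Qed.

Lemma sum_card0_apply_at (K : fieldType) (V : lmodType K) (n : nat)
    (g : mLie n V) (N : V -> V) (x : {ffun 'I_n -> V}) :
  \sum_(J : {set 'I_n} | #|J| == 0%N) g (apply_at N J x) = g x.
Proof.
rewrite (big_pred1 set0) => [|J]; last by rewrite /= cards_eq0.
by congr (g _); apply/ffunP => i; rewrite ffunE inE.
Qed.

Lemma bracketNS (K : fieldType) (V : lmodType K) (m : nat) (g : mLie m V)
    (N : {linear V -> V}) (j : nat) (x : {ffun 'I_m -> V}) :
  bracketN g N j.+1 x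
  = \sum_(I : {set 'I_m} | #|I| == j.+1) g (apply_at N I x)
    - N (bracketN g N j x).
Proof. by []. Qed.

Lemma bracketN_extend (K : fieldType) (V : lmodType K) (n : nat)
    (g : mLie n V) (f : {scalar V})
    (hf : forall x : {ffun 'I_n -> V}, f (g x) = 0)
    (N : {linear V -> V}) (j : nat) (x : {ffun 'I_n.+1 -> V}) :
  bracketN (extend hf) N j.+1 x
  = \sum_(i < n.+1)
      (((-1) ^+ i * f (x i)) *: bracketN g N j.+1 (omit x i)
       + ((-1) ^+ i * f (N (x i))) *: bracketN g N j (omit x i)).
Proof.
elim: j => [|j IHj].
  rewrite bracketNS sum_extend_apply_at linear_sum -sumrB.
  (* The coefficient of [f (N (x i))] is level 0, the bracket itself, with no [N] term to
     subtract. *)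
  apply: eq_bigr => i _; rewrite bracketNS sum_card0_apply_at.
  by rewrite linearZ /= scalerBr addrAC.
rewrite bracketNS IHj sum_extend_apply_at linear_sum -sumrB.
apply: eq_bigr => i _; rewrite (bracketNS _ _ _ g N j.+1)
  (bracketNS _ _ _ g N j).
(* Grouped by [f (x i)] and [f (N (x i))], each sum over position sets meets the [N] term that its
   own recursion subtracts. *)
by rewrite linearD !linearZ !scalerBr /= opprD addrACA.
Qed.

(** The only set of [m] positions is the full one, so level [m] is the difference of the two sides
    of the Nijenhuis identity. *)
Lemma Nijenhuis_bracketN (K : fieldType) (V : lmodType K) (m : nat)
    (g : mLie m V) (N : {linear V -> V}) :
  (0 < m)%N ->
  Nijenhuis g N <-> forall x : {ffun 'I_m -> V}, bracketN g N m x = 0.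
Proof.
move=> m_gt0.
have E x : bracketN g N m x = g [ffun i => N (x i)] - N (bracketN g N m.-1 x).
  rewrite -{2}(prednK m_gt0) /= (prednK m_gt0) (big_pred1 setT) => [|I].
    by congr (g _ - _); apply/ffunP => i; rewrite !ffunE inE.
  by rewrite /= -[X in _ == X]card_ord -cardsT eqEcard subsetT /= eqn_leq
             subset_leq_card ?subsetT.
by split=> h x; [rewrite E h subrr | apply/eqP; rewrite -subr_eq0 -E h].
Qed.

(** No set of [m.+1] positions exists, so the sum in the recursion is empty. *)
Lemma bracketN_gt_arity (K : fieldType) (V : lmodType K) (m : nat)
    (g : mLie m V) (N : {linear V -> V}) (x : {ffun 'I_m -> V}) :
  bracketN g N m.+1 x = - N (bracketN g N m x).
Proof.
rewrite /= big_pred0 ?sub0r // => I; apply/negbTE.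
by rewrite neq_ltn ltnS -[X in (_ <= X)%N]card_ord max_card.
Qed.

Theorem theorem4p2 (K : fieldType) (V : lmodType K) (n : nat) (hn : (2 <= n)%N)
    (g : mLie n V) (f : {scalar V})
    (hf : forall x : {ffun 'I_n -> V}, f (g x) = 0)
    (N : {linear V -> V}) (hN : Nijenhuis g N) :
  Nijenhuis (extend hf) N.
Proof.
have {}hN := (Nijenhuis_bracketN _ _ _ g N (ltnW hn)).1 hN.
apply/Nijenhuis_bracketN => // x.
rewrite bracketN_extend big1 // => i _.
by rewrite bracketN_gt_arity hN raddf0 oppr0 !scaler0 addr0.
Qed.
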